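(* Let $E_n$ be the Euler numbers, defined by $\sum_{n\ge0}E_n\frac{t^n}{n!}=\frac{2}{e^t+e^{-t}}$. Let $T(n,k)$ be the central factorial numbers of the second kind, defined by $(e^{x/2}-e^{-x/2})^k=k!\sum_{n\ge k}T(n,k)\frac{x^n}{n!}$ (so $T(0,0)=1$). Let $\Delta(x,k)$ be the polynomials defined by $\Delta(x,0)=1$ and $$\Delta(x,k+1)=(x+1)(2x+1)\Delta(x+1,k)-x^2\Delta(x,k)\quad(k\ge0).$$ Then for all non-negative integers $n$ and $k$, $$E_{2n+2k}=\sum_{j=0}^n\frac{(-1)^{j-k}(2j)!\,\Delta(j,k)}{2^j}\,T(2n,2j).$$ *)

(* Defs.v *)
From mathcomp Require Import all_boot all_order all_algebra.

Set Implicit Arguments.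
Unset Strict Implicit.
Unset Printing Implicit Defensive.

Import Order.TTheory GRing.Theory Num.Theory.
Local Open Scope ring_scope.

(* A formal power series over rat is the sequence of its coefficients. *)
Definition fps := nat -> rat.

Definition fps_const (c : rat) : fps := fun n => if n is 0%N then c else 0.
Definition fps_add (a b : fps) : fps := fun n => a n + b n.
Definition fps_sub (a b : fps) : fps := fun n => a n - b n.
Definition fps_mul (a b : fps) : fps :=
  fun n => \sum_(i < n.+1) a i * b (n - i)%N.
Definition fps_pow (a : fps) (k : nat) : fps := iter k (fps_mul a) (fps_const 1).

(* The first n coefficients of the inverse of a, obtained by solving
   a * b = 1 degree by degree; meaningful when a 0 != 0 (see fps_mulV). *)
Fixpoint fps_inv_seq (a : fps) (n : nat) : seq rat :=
  if n is m.+1 then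
    let s := fps_inv_seq a m in
    rcons s ((fps_const 1 m - \sum_(i < m) s`_i * a (m - i)%N) / a 0%N)
  else [::].
Definition fps_inv (a : fps) : fps := fun n => (fps_inv_seq a n.+1)`_n.

(* The series e^(c t). *)
Definition fps_exp (c : rat) : fps := fun n => c ^+ n / (n`!)%:R.

(* E_n = n! [t^n] 2 / (e^t + e^-t) *)
Definition euler (n : nat) : rat :=
  (n`!)%:R *
  fps_mul (fps_const 2) (fps_inv (fps_add (fps_exp 1) (fps_exp (-1)))) n.

(* T(n,k) = (n!/k!) [x^n] (e^(x/2) - e^(-x/2))^k *)
Definition cfact2 (n k : nat) : rat :=
  (n`!)%:R / (k`!)%:R *
  fps_pow (fps_sub (fps_exp (1 / 2)) (fps_exp (- (1 / 2)))) k n.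

Fixpoint Delta (k : nat) : {poly rat} :=
  if k is m.+1 then
    ('X + 1) * (2%:R *: 'X + 1) * (Delta m \Po ('X + 1)) - 'X ^+ 2 * Delta m
  else 1.

Lemma size_fps_inv_seq (a : fps) n : size (fps_inv_seq a n) = n.
Proof. by elim: n => //= n IH; rewrite size_rcons IH. Qed.

Lemma nth_fps_inv_seq (a : fps) n i :
  (i < n)%N -> (fps_inv_seq a n)`_i = fps_inv a i.
Proof.
elim: n => // n IH; rewrite ltnS leq_eqVlt => /orP[/eqP-> //|lt_in].
by rewrite /= nth_rcons size_fps_inv_seq lt_in IH.
Qed.

Lemma fps_mulV (a : fps) n :
  a 0%N != 0 -> fps_mul (fps_inv a) a n = fps_const 1 n.
Proof.
move=> a0; rewrite /fps_mul big_ord_recr /= subnn.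
rewrite {2}/fps_inv /= nth_rcons size_fps_inv_seq ltnn eqxx divfK //.
rewrite (eq_bigr (fun i : 'I_n => (fps_inv_seq a n)`_i * a (n - i)%N)).
  by rewrite addrC subrK.
by move=> i _; rewrite nth_fps_inv_seq.
Qed.

Lemma euler_egf n :
  fps_mul (fun m => euler m / (m`!)%:R)
          (fps_add (fps_exp 1) (fps_exp (-1))) n = fps_const 2 n.
Proof.
set d := fps_add _ _.
have d0 : d 0%N != 0 by [].
have mulC2 i : fps_mul (fps_const 2) (fps_inv d) i = 2 * fps_inv d i.
  by rewrite /fps_mul big_ord_recl /= subn0 big1 ?addr0 // => j _; rewrite mul0r.
transitivity (2 * fps_mul (fps_inv d) d n).
  rewrite /fps_mul mulr_sumr; apply: eq_bigr => i _.
  rewrite /euler -/d mulC2 [RHS]mulrA; congr (_ * _).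
  by rewrite mulrC mulKf // pnatr_eq0 -lt0n fact_gt0.
by rewrite fps_mulV //; case: n => [|n] /=; rewrite ?mulr1 ?mulr0.
Qed.

(* Hence the sum defining T(n,k) may be restricted to n >= k. *)
Lemma cfact2_small n k : (n < k)%N -> cfact2 n k = 0.
Proof.
move=> lt_nk; rewrite /cfact2; set a := fps_sub _ _.
suff -> : fps_pow a k n = 0 by rewrite mulr0.
have a0 : a 0%N = 0 by [].
elim: k n lt_nk => // k IH n; rewrite ltnS => le_nk.
rewrite /fps_pow iterS -/(fps_pow a k) /fps_mul big_ord_recl /= a0 mul0r add0r.
apply: big1 => i _; rewrite IH ?mulr0 //= /bump /=.
apply: leq_trans le_nk; rewrite add1n; case: n i => [|n] i; first by case: i.
by rewrite subSS ltnS leq_subr.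
Qed.

Lemma cfact2_egf n k :
  fps_pow (fps_sub (fps_exp (1 / 2)) (fps_exp (- (1 / 2)))) k n
  = (k`!)%:R * (cfact2 n k / (n`!)%:R).
Proof.
have fact_neq0 m : ((m`!)%:R : rat) != 0 by rewrite pnatr_eq0 -lt0n fact_gt0.
rewrite /cfact2; set c := fps_pow _ _ _.
by rewrite -[_ / _ * c]mulrA [_%:R * (_ * c)]mulrC mulfK // mulVKf.
Qed.

(* Main.v *)
(** A power series [f] acts on polynomials through the linear functional
    [p |-> (f(D) p)(0)], where [D] is the derivation. As [e^(c D)] is
    translation by [c], the series [s = e^(t/2) - e^(-t/2)] acts as the central
    difference operator [delta], so that [k! T(n,k) = (delta^k x^n)(0)]; and
    [2 / (e^t + e^(-t)) = 2 / (2 + s^2)] gives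
    [E_n = \sum_j (-1/2)^j (delta^(2j) x^n)(0)], the case [k = 0]. From the
    commutation of [delta] with multiplication by [x] one gets
    [(delta^(2j) (x^2 p))(0) = j^2 (delta^(2j) p)(0)
       + 2j (2j-1) (delta^(2j-2) p)(0)],
    so replacing [x^n] by [x^2 x^n] turns coefficients [a_j] into
    [j^2 a_j + (2j+1) (2j+2) a_(j+1)]; for [a_j = (-1)^(j-k) Delta(j,k) / 2^j]
    this is exactly the recurrence defining [Delta]. *)

Require Import Defs.
From HB Require Import structures.
From mathcomp Require Import all_boot all_algebra.
From mathcomp Require Import ring zify.
Set Implicit Arguments.
Unset Strict Implicit.
Unset Printing Implicit Defensive.
Import GRing.Theory Num.Theory.
Local Open Scope ring_scope.

Lemma eq_linear_polyXn (R : nzRingType) (V : zmodType)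
    (s : GRing.Scale.law R V) (f g : {linear {poly R} -> V | s}) :
  (forall n, f 'X^n = g 'X^n) -> f =1 g.
Proof.
move=> eq_fg p; rewrite -(coefK p) poly_def !linear_sum.
by apply: eq_bigr => i _; rewrite !linearZ eq_fg.
Qed.

Lemma exprzN1B (R : unitRingType) (j k : nat) :
  (-1) ^ (j%:Z - k%:Z) = (-1) ^+ (j + k) :> R.
Proof.
by rewrite exprzDr ?unitrN1 // -exprz_inv invrN1 -exprzD_nat -exprnP.
Qed.

Lemma natr_fact_neq0 (R : numDomainType) n : n`!%:R != 0 :> R.
Proof. by rewrite pnatr_eq0 -lt0n fact_gt0. Qed.

Section CentralDifference.
Variable R : comNzRingType.
Implicit Types (a b h : R) (p : {poly R}).

Definition shift a p : {poly R} := p \Po ('X + a%:P).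

HB.instance Definition _ a :=
  GRing.Linear.copy (shift a) (comp_poly ('X + a%:P)).

Lemma shift0 p : shift 0 p = p.
Proof. by rewrite /shift addr0 comp_polyXr. Qed.

Lemma shift_shift a b p : shift a (shift b p) = shift (a + b) p.
Proof.
rewrite /shift -comp_polyA comp_polyD comp_polyX comp_polyC.
by rewrite -addrA -polyCD.
Qed.

Lemma shiftXM a p : shift a ('X * p) = ('X + a%:P) * shift a p.
Proof. by rewrite /shift comp_polyM comp_polyX. Qed.

Lemma size_shift_leq a p : (size (shift a p) <= size p)%N.
Proof.
have [->|p_neq0] := eqVneq p 0; first by rewrite linear0.
apply: leq_trans (size_comp_poly_leq _ _) _.
by rewrite size_XaddC muln1 prednK // size_poly_gt0.
Qed.

Definition cdiff h p : {poly R} := shift h p - shift (- h) p.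
Definition csum h p : {poly R} := shift h p + shift (- h) p.

HB.instance Definition _ h :=
  GRing.Linear.copy (cdiff h) (shift h \- shift (- h)).
HB.instance Definition _ h :=
  GRing.Linear.copy (csum h) (shift h \+ shift (- h)).

Lemma cdiffXM h p : cdiff h ('X * p) = 'X * cdiff h p + h *: csum h p.
Proof. by rewrite /cdiff /csum !shiftXM -mul_polyC polyCN; ring. Qed.

Lemma csumXM h p : csum h ('X * p) = 'X * csum h p + h *: cdiff h p.
Proof. by rewrite /cdiff /csum !shiftXM -mul_polyC polyCN; ring. Qed.

Lemma cdiff_csum h p : cdiff h (csum h p) = csum h (cdiff h p).
Proof.
rewrite /cdiff /csum !raddfB !raddfD /= !shift_shift [- h + h]addrC.
by ring.
Qed.

Lemma cdiff_cdiff h p :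
  cdiff h (cdiff h p) = csum (h + h) p - p *+ 2.
Proof.
rewrite {1}/cdiff !raddfB /= !shift_shift subrr addNr shift0 /csum (opprD h).
by ring.
Qed.

Lemma csum_csum h p : csum h (csum h p) = cdiff h (cdiff h p) + p *+ 4.
Proof.
rewrite cdiff_cdiff {1}/csum !raddfD /= !shift_shift subrr addNr shift0.
by rewrite /csum (opprD h); ring.
Qed.

Lemma size_cdiff_leq h p : (size (cdiff h p) <= (size p).-1)%N.
Proof.
elim/poly_ind: p => [|p c IHp]; first by rewrite linear0 size_poly0.
have cdiffC : cdiff h c%:P = 0 by rewrite /cdiff /shift !comp_polyC subrr.
have [->|p_neq0] := eqVneq p 0; first by rewrite mul0r add0r cdiffC size_poly0.
rewrite size_MXaddC (negPf p_neq0) /= linearD /= cdiffC addr0 mulrC cdiffXM.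
have lt_size : ((size (cdiff h p)).+1 <= size p)%N.
  by apply: leq_ltn_trans IHp _; rewrite ltn_predL size_poly_gt0.
apply: leq_trans (size_polyD _ _) _; rewrite geq_max; apply/andP; split.
  by apply: leq_trans (size_polyMleq _ _) _; rewrite size_polyX.
apply: leq_trans (size_scale_leq _ _) _.
by apply: leq_trans (size_polyD _ _) _; rewrite geq_max !size_shift_leq.
Qed.

Lemma size_iter_cdiff_leq h k p : (size (iter k (cdiff h) p) <= size p - k)%N.
Proof.
elim: k => [|k IHk]; first by rewrite subn0.
by rewrite iterS subnS; apply: leq_trans (size_cdiff_leq _ _) _; lia.
Qed.

Lemma iter_cdiffXM h k p :
  iter k.+1 (cdiff h) ('X * p) =
  'X * iter k.+1 (cdiff h) p + (k.+1%:R * h) *: csum h (iter k (cdiff h) p).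
Proof.
elim: k => [|k IHk]; first by rewrite mul1r /= cdiffXM.
rewrite iterS IHk linearD linearZ /= cdiffXM cdiff_csum -!iterS.
by rewrite -addrA -scalerDl -[k.+2%:R]natr1; congr (_ + _ *: _); ring.
Qed.

Definition cdiff0 h k p : R := (iter k (cdiff h) p).[0].

Lemma cdiff0_eq0 h k p : (size p <= k)%N -> cdiff0 h k p = 0.
Proof.
move=> le_pk; rewrite /cdiff0.
suff -> : iter k (cdiff h) p = 0 by rewrite horner0.
apply/eqP; rewrite -size_poly_leq0.
by apply: leq_trans (size_iter_cdiff_leq _ _ _) _; lia.
Qed.

Lemma cdiff0XM h k p :
  cdiff0 h k ('X * p) = k%:R * h * (csum h (iter k.-1 (cdiff h) p)).[0].
Proof.
case: k => [|k]; first by rewrite /cdiff0 /= hornerM hornerX !mul0r.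
by rewrite /cdiff0 iter_cdiffXM hornerD hornerZ hornerM hornerX mul0r add0r.
Qed.

Lemma cdiff0X2M h k p :
  cdiff0 h k.+2 ('X^2 * p) =
  (k.+2%:R * h) ^+ 2 * cdiff0 h k.+2 p
  + (h + h) ^+ 2 * (k.+2%:R * k.+1%:R) * cdiff0 h k p.
Proof.
rewrite expr2 -mulrA cdiff0XM iter_cdiffXM /cdiff0.
rewrite linearD linearZ /= csumXM csum_csum.
rewrite !(hornerD, hornerM, hornerZ, hornerX, hornerMn).
by rewrite -[k.+2%:R]natr1 -[k.+1%:R]natr1; ring.
Qed.

Lemma sum_cdiff0X2M h (a : nat -> R) n p : (size p <= 2 * n)%N ->
  \sum_(0 <= j < n.+1) a j * cdiff0 h (2 * j) ('X^2 * p) =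
  (h + h) ^+ 2 * \sum_(0 <= j < n)
    (j%:R ^+ 2 * a j + (2 * j.+1)%:R * (2 * j).+1%:R * a j.+1)
    * cdiff0 h (2 * j) p.
Proof.
move=> le_pn.
pose diag j := (h + h) ^+ 2 * (j%:R ^+ 2 * a j) * cdiff0 h (2 * j) p.
have sum_diagS : \sum_(0 <= j < n) diag j.+1 = \sum_(0 <= j < n) diag j.
  have diag0 : diag 0%N = 0 by rewrite /diag expr0n /= mul0r mulr0 mul0r.
  have diagn : diag n = 0 by rewrite /diag cdiff0_eq0 // mulr0.
  apply/eqP; rewrite -subr_eq0 -sumrB telescope_sumr //.
  by rewrite diagn diag0 subrr.
have cdiff0_zeroX2M : cdiff0 h (2 * 0) ('X^2 * p) = 0.
  by rewrite expr2 -mulrA cdiff0XM !mul0r.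
rewrite big_nat_recl // cdiff0_zeroX2M mulr0 add0r.
transitivity (\sum_(0 <= j < n) (diag j.+1 + (h + h) ^+ 2
    * ((2 * j.+1)%:R * (2 * j).+1%:R * a j.+1) * cdiff0 h (2 * j) p)).
  apply: eq_bigr => j _; rewrite /diag mulnS add2n cdiff0X2M.
  have -> : (2 * j).+2%:R = 2 * j.+1%:R :> R by rewrite -natrM mulnS.
  by ring.
rewrite big_split /= sum_diagS -big_split mulr_sumr /=.
by apply: eq_bigr => j _; rewrite /diag; ring.
Qed.

End CentralDifference.

Section UmbralFunctional.
Implicit Types (f g : fps) (p : {poly rat}).

Lemma fps_mulC f g : fps_mul f g =1 fps_mul g f.
Proof.
move=> n; rewrite /fps_mul (reindex_inj rev_ord_inj) /=.
by apply: eq_bigr => i _; rewrite subSS subKn 1?mulrC // -ltnS.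
Qed.

Lemma fps_mulDl f1 f2 g :
  fps_mul (fps_add f1 f2) g =1 fps_add (fps_mul f1 g) (fps_mul f2 g).
Proof.
by move=> n; rewrite -[RHS]big_split; apply: eq_bigr => i _; rewrite mulrDl.
Qed.

Lemma fps_mulBl f1 f2 g :
  fps_mul (fps_sub f1 f2) g =1 fps_sub (fps_mul f1 g) (fps_mul f2 g).
Proof.
by move=> n; rewrite -[RHS]sumrB; apply: eq_bigr => i _; rewrite mulrBl.
Qed.

Definition fps_exp_diff a : fps := fps_sub (fps_exp a) (fps_exp (- a)).
Definition fps_exp_sum a : fps := fps_add (fps_exp a) (fps_exp (- a)).

Definition egf (u : nat -> rat) : fps := fun n => u n / n`!%:R.

(* [umbral f p] is [(f(D) p)(0)], as [i`! * p`_i] is the [i]-th derivative of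
   [p] at [0]. *)
Definition umbral f p : rat := \sum_(i < size p) (i`!%:R * f i) * p`_i.

Lemma umbral_wide f n p : (size p <= n)%N ->
  umbral f p = \sum_(i < n) (i`!%:R * f i) * p`_i.
Proof.
move=> le_pn; rewrite /umbral.
rewrite (big_ord_widen n (fun i => (i`!%:R * f i) * p`_i)) // big_mkcond.
apply: eq_bigr => i _; case: ltnP => // le_pi.
by rewrite nth_default ?mulr0.
Qed.

Fact umbral_is_scalar f : scalar (umbral f).
Proof.
move=> a p q; set n := maxn (size p) (size q).
have le_n : (size (a *: p + q)%R <= n)%N.
  apply: leq_trans (size_polyD _ _) _; rewrite geq_max leq_maxr andbT.
  exact: leq_trans (size_scale_leq _ _) (leq_maxl _ _).
rewrite (umbral_wide _ le_n) (umbral_wide f (leq_maxl _ (size q))).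
rewrite (umbral_wide f (leq_maxr (size p) _)) mulr_sumr -big_split /=.
by apply: eq_bigr => i _; rewrite coefD coefZ; ring.
Qed.
HB.instance Definition _ f :=
  GRing.isLinear.Build rat {poly rat} rat *%R (umbral f) (umbral_is_scalar f).

Lemma umbralXn f n : umbral f 'X^n = n`!%:R * f n.
Proof.
rewrite /umbral size_polyXn big_ord_recr /= big1 ?add0r => [|i _].
  by rewrite coefXn eqxx mulr1.
by rewrite coefXn ltn_eqF ?mulr0.
Qed.

Lemma eq_umbral f g : f =1 g -> umbral f =1 umbral g.
Proof. by move=> eq_fg p; apply: eq_bigr => i _; rewrite eq_fg. Qed.

Lemma umbral_const c p : umbral (fps_const c) p = c * p.[0].
Proof.
rewrite (umbral_wide _ (leqnSn _)) big_ord_recl big1 => [|i _].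
  by rewrite addr0 mul1r horner_coef0.
by rewrite /= mulr0 mul0r.
Qed.

Lemma umbralD f g p : umbral (fps_add f g) p = umbral f p + umbral g p.
Proof. by rewrite -big_split; apply: eq_bigr => i _; rewrite mulrDr mulrDl. Qed.

Lemma umbralB f g p : umbral (fps_sub f g) p = umbral f p - umbral g p.
Proof. by rewrite -sumrB; apply: eq_bigr => i _; rewrite mulrBr mulrBl. Qed.

Lemma umbral_expM a f p :
  umbral (fps_mul (fps_exp a) f) p = umbral f (shift a p).
Proof.
pose rhs := umbral f \o shift a; rewrite -[RHS]/(rhs p); move: p.
apply: eq_linear_polyXn => n /=.
rewrite umbralXn /shift comp_Xn_poly exprDn linear_sum mulr_sumr.
apply: eq_bigr => i _ /=.
rewrite -polyC_exp [_ * _%:P]mulrC mul_polyC linearMn linearZ /= umbralXn.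
have le_in : (i <= n)%N by rewrite -ltnS.
rewrite -mulr_natr -(bin_fact le_in) !natrM /fps_exp.
by field; exact: natr_fact_neq0.
Qed.

Lemma umbral_exp_diffM a f p :
  umbral (fps_mul (fps_exp_diff a) f) p = umbral f (cdiff a p).
Proof.
by rewrite (eq_umbral (fps_mulBl _ _ _)) umbralB !umbral_expM linearB.
Qed.

Lemma umbral_exp_sumM a f p :
  umbral (fps_mul (fps_exp_sum a) f) p = umbral f (csum a p).
Proof.
by rewrite (eq_umbral (fps_mulDl _ _ _)) umbralD !umbral_expM linearD.
Qed.

Lemma umbral_exp_diffX a k p :
  umbral (fps_pow (fps_exp_diff a) k) p = cdiff0 a k p.
Proof.
elim: k p => [|k IHk] p; first by rewrite umbral_const mul1r.
by rewrite /fps_pow iterS umbral_exp_diffM -/(fps_pow _ _) IHk /cdiff0 iterSr.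
Qed.

Lemma umbral_egfXn u n : umbral (egf u) 'X^n = u n.
Proof. by rewrite umbralXn mulrC divfK // natr_fact_neq0. Qed.

Lemma cdiff0_cfact2 n k : cdiff0 (1 / 2) k 'X^n = k`!%:R * cfact2 n k.
Proof.
rewrite -umbral_exp_diffX umbralXn cfact2_egf mulrCA [cfact2 _ _ / _]mulrC.
by rewrite mulVKf // natr_fact_neq0.
Qed.

Lemma umbral_euler_csum p : umbral (egf euler) (csum 1 p) = 2 * p.[0].
Proof.
rewrite -umbral_exp_sumM (eq_umbral (fps_mulC _ _)) (eq_umbral euler_egf).
exact: umbral_const.
Qed.

Lemma umbral_euler_cdiff0 n p : (size p <= 2 * n)%N ->
  umbral (egf euler) p =
  \sum_(0 <= j < n) (-1 / 2) ^+ j * cdiff0 (1 / 2) (2 * j) p.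
Proof.
elim: n p => [|n IHn] p le_pn.
  by move: le_pn; rewrite muln0 => /size_poly_leq0P->; rewrite big_nil linear0.
pose dd_p := cdiff (1 / 2) (cdiff (1 / 2) p).
have le_dd_p : (size dd_p <= 2 * n)%N.
  apply: leq_trans (size_iter_cdiff_leq (1 / 2) 2 p) _.
  by rewrite leq_subLR -mulnS.
have euler_dd : umbral (egf euler) p = p.[0] - 1 / 2 * umbral (egf euler) dd_p.
  rewrite /dd_p cdiff_cdiff -splitr linearB linearMn /= umbral_euler_csum.
  by field.
rewrite euler_dd IHn // big_nat_recl //.
congr (_ + _); first by rewrite expr0 !mul1r.
rewrite -mulNr mulr_sumr; apply: eq_bigr => j _.
by rewrite /cdiff0 mulnS add2n 2!iterSr exprS; ring.
Qed.

Definition euler_coef k j : rat :=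
  (-1) ^ (j%:Z - k%:Z) * (Delta k).[j%:R] / 2 ^+ j.

Lemma euler_coef0 j : euler_coef 0 j = (-1 / 2) ^+ j.
Proof. by rewrite /euler_coef exprzN1B addn0 hornerC mulr1 expr_div_n. Qed.

Lemma euler_coefS k j :
  euler_coef k.+1 j = j%:R ^+ 2 * euler_coef k j
    + (2 * j.+1)%:R * (2 * j).+1%:R * euler_coef k j.+1.
Proof.
have Delta_rec (x : rat) : (Delta k.+1).[x] =
    (x + 1) * (2 * x + 1) * (Delta k).[x + 1] - x ^+ 2 * (Delta k).[x].
  by rewrite /= !hornerE horner_comp !hornerE.
rewrite /euler_coef Delta_rec !exprzN1B addnS addSn !exprS.
rewrite -[(2 * j).+1%:R]natr1 !natrM -!natr1.
by field; rewrite expf_neq0.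
Qed.

Lemma umbral_eulerX2nM k n p : (size p <= 2 * n)%N ->
  umbral (egf euler) ('X^(2 * k) * p) =
  \sum_(0 <= j < n) euler_coef k j * cdiff0 (1 / 2) (2 * j) p.
Proof.
elim: k n p => [|k IHk] n p le_pn.
  rewrite muln0 expr0 mul1r (umbral_euler_cdiff0 le_pn).
  by apply: eq_bigr => j _; rewrite euler_coef0.
have le_X2p : (size ('X^2 * p)%R <= 2 * n.+1)%N.
  by apply: leq_trans (size_polyMleq _ _) _; rewrite size_polyXn; lia.
rewrite mulnS addnC exprD -mulrA (IHk _ _ le_X2p) sum_cdiff0X2M //.
rewrite -splitr expr1n mul1r.
by apply: eq_bigr => j _; rewrite euler_coefS.
Qed.

End UmbralFunctional.

Theorem theorem5 (n k : nat) :
  euler (2 * n + 2 * k) =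
  \sum_(0 <= j < n.+1)
     ((-1) ^ (j%:Z - k%:Z) * ((2 * j)`!)%:R * (Delta k).[j%:R] / 2 ^+ j)
     * cfact2 (2 * n) (2 * j).
Proof.
rewrite -(umbral_egfXn euler) addnC exprD (@umbral_eulerX2nM k n.+1).
  by apply: eq_bigr => j _; rewrite cdiff0_cfact2 /euler_coef; ring.
by rewrite size_polyXn; lia.
Qed.
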